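(* Let $A$ and $B$ be Banach algebras (over the same scalar field $\mathbb{R}$ or $\mathbb{C}$) and let $J\subseteq A$ be a closed (two-sided) ideal. (i) If $A$ has open (respectively: uniformly open, weakly open) multiplication, then $A/J$ has open (respectively: uniformly open, weakly open) multiplication. Moreover, in the open and the uniformly open cases, the dependence of $\delta$ on $\varepsilon$ in the quotient algebra is the same as in $A$: in the open case, if $\delta$ is admissible for $\varepsilon$ at $(x,y)\in A\times A$, then it is admissible for $\varepsilon$ at $(x+J,y+J)$ in $A/J$; in the uniformly open case, any function $\varepsilon\mapsto\delta(\varepsilon)$ witnessing uniform openness of multiplication in $A$ also witnesses uniform openness of multiplication in $A/J$. (ii) If $h\colon A\to B$ is a surjective bounded algebra homomorphism and $A$ has open (respectively: uniformly open) multiplication, then $B$ has open (respectively: uniformly open) multiplication.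
   Context: $B(x,r)$ denotes the open ball with centre $x$ and radius $r$, and $U\cdot V=\{uv\colon u\in U,v\in V\}$. For a Banach algebra $A$, $x,y\in A$ and $\varepsilon>0$, say that $\delta>0$ is admissible for $\varepsilon$ at $(x,y)$ if $B(xy,\delta)\subseteq B(x,\varepsilon)\cdot B(y,\varepsilon)$. Multiplication in $A$ is open if for all $x,y\in A$ and $\varepsilon>0$ there is an admissible $\delta>0$ for $\varepsilon$ at $(x,y)$ (equivalently, $(a,b)\mapsto ab$ maps open sets to open sets); it is uniformly open if $\delta=\delta(\varepsilon)$ can be chosen independently of $x,y$; it is weakly open if $(a,b)\mapsto ab$ maps every non-empty open subset of $A\times A$ to a set with non-empty interior. $A/J$ carries the quotient norm. *)

(* Defs.v *)
From HB Require Import structures.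
From mathcomp Require Import all_boot all_order all_algebra.
From mathcomp Require Import generic_quotient ring_quotient complex.
From mathcomp Require Import all_classical all_reals.
From mathcomp Require Import topology normedtype sequences.

Set Implicit Arguments.
Unset Strict Implicit.
Unset Printing Implicit Defensive.

Import Order.TTheory GRing.Theory Num.Theory.
Import numFieldNormedType.Exports.

Local Open Scope classical_set_scope.
Local Open Scope ring_scope.
Local Open Scope quotient_scope.

Variant scalar_kind := RealScalars | ComplexScalars.

Definition scalars (R : realType) (s : scalar_kind) : numFieldType :=
  match s with RealScalars => R | ComplexScalars => R[i] end.

(* A Banach algebra is not required to have a unit, so it is not built on the
   (unital) ring structures of the library. *)
HB.mixin Record isBanachAlgebra (K : numFieldType) A
    of CompleteNormedModule K A := {
  bmul : A -> A -> A;
  bmulA : associative bmul;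
  bmulDl : left_distributive bmul +%R;
  bmulDr : right_distributive bmul +%R;
  bmulZl : forall (k : K) x y, bmul (k *: x) y = k *: bmul x y;
  bmulZr : forall (k : K) x y, bmul x (k *: y) = k *: bmul x y;
  normr_bmul_le : forall x y, `|bmul x y| <= `|x| * `|y|
}.

#[short(type="banachAlgType")]
HB.structure Definition BanachAlgebra (K : numFieldType) :=
  {A of CompleteNormedModule K A & isBanachAlgebra K A}.

Notation "x ** y" := (bmul x y) (at level 40, left associativity) : ring_scope.

Record closed_ideal (K : numFieldType) (A : banachAlgType K) := ClosedIdeal {
  ideal_set : set A;
  ideal0 : ideal_set 0;
  idealD : forall x y, ideal_set x -> ideal_set y -> ideal_set (x + y);
  idealZ : forall (k : K) x, ideal_set x -> ideal_set (k *: x);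
  ideal_mull : forall a x, ideal_set x -> ideal_set (a ** x);
  ideal_mulr : forall a x, ideal_set x -> ideal_set (x ** a);
  ideal_closed : closed ideal_set
}.

Section IdealPredicate.
Variables (K : numFieldType) (A : banachAlgType K) (J : closed_ideal A).

Definition ideal_pred : {pred A} := fun x => `[< ideal_set J x >].

Lemma ideal_predP x : reflect (ideal_set J x) (x \in ideal_pred).
Proof. exact: asboolP. Qed.

Fact ideal_zmod_closed : zmod_closed ideal_pred.
Proof.
split=> [|x y /ideal_predP Jx /ideal_predP Jy]; apply/ideal_predP.
  exact: ideal0.
by rewrite -scaleN1r; apply: idealD => //; exact: idealZ.
Qed.

HB.instance Definition _ := GRing.isZmodClosed.Build A ideal_pred
  ideal_zmod_closed.

End IdealPredicate.

Section ScalarInfima.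
Variables (R : realType) (s : scalar_kind).

Lemma scalars_infimums (S : set (scalars R s)) :
  S !=set0 -> (forall x, S x -> 0 <= x) -> infimums S !=set0.
Proof.
case: s S => /= S [x0 Sx0] S0.
  have hS : has_inf S by split; [exists x0 | exists 0 => x /S0].
  exists (inf S); split; first by move=> x Sx; exact: ge_inf hS.2 _ Sx.
  by move=> m mS; apply: lb_le_inf => //; exists x0.
pose T := [set complex.Re z | z in S].
have SRe z : S z -> z = (complex.Re z)%:C%C.
  by move=> /S0; case: z => a b; rewrite lecE /= => /andP[/eqP -> _].
have T0 : T !=set0 by exists (complex.Re x0); exists x0.
have lT : lbound T 0.
  by move=> _ [z /S0 + <-]; case: z => a b; rewrite lecE => /andP[].
exists (inf T)%:C%C; split.
  move=> z Sz; rewrite (SRe z Sz) lecR; apply: ge_inf; last by exists z.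
  by exists 0.
move=> m mS.
have mE : m = (complex.Re m)%:C%C.
  have := mS _ Sx0; rewrite (SRe _ Sx0); case: m {mS} => a b.
  by rewrite lecE /= => /andP[/eqP <- _].
rewrite mE lecR; apply: lb_le_inf => // _ [z Sz <-].
by have := mS _ Sz; rewrite mE (SRe _ Sz) lecR.
Qed.

Lemma scalars_exp2V_lt (e : scalars R s) : 0 < e ->
  exists n, (2 ^+ n)^-1 < e.
Proof.
have aux (x : R) : 0 < x -> exists n, (2 ^+ n)^-1 < x.
  move=> x0; have xV : 0 < x^-1 by rewrite invr_gt0.
  exists (Num.bound x^-1); rewrite invf_plt ?posrE ?exprn_gt0 //.
  apply: lt_trans (archi_boundP (ltW xV)) _.
  by rewrite -natrX ltr_nat ltn_expl.
case: s e => /= e; first exact: aux.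
case: e => a b; rewrite ltcE /= => /andP[/eqP -> a0].
have [n na] := aux a a0; exists n.
rewrite -[2%R]/(1 + 1) -(rmorph1 (real_complex R)) -rmorphD -rmorphXn -fmorphV.
by rewrite -[(a +i* 0)%C]/(a%:C)%C ltcR.
Qed.

End ScalarInfima.

Section QuotientModule.
Variables (K : numFieldType) (A : banachAlgType K) (J : closed_ideal A).

Definition quotient_algebra : Type := {ideal_quot (ideal_pred J)}.

HB.instance Definition _ := GRing.Zmodule.on quotient_algebra.

Definition quotient_class (x : A) : quotient_algebra := \pi_{ideal_quot (ideal_pred J)} x.

Definition quotient_repr (q : quotient_algebra) : A := repr (q : {ideal_quot (ideal_pred J)}).

Lemma quotient_reprK : cancel quotient_repr quotient_class.
Proof. exact: reprK. Qed.

Lemma quotient_classP x y :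
  (quotient_class x = quotient_class y) <-> ideal_set J (x - y).
Proof.
split=> [/eqP xy|Jxy]; [apply/ideal_predP|apply/eqP]; rewrite ?Quotient.idealrBE //.
by rewrite -Quotient.idealrBE; apply/ideal_predP.
Qed.

Lemma quotient_class0 : quotient_class 0 = 0.
Proof. by rewrite /quotient_class raddf0. Qed.

Lemma quotient_classD : {morph quotient_class : x y / x + y}.
Proof. by move=> x y; rewrite /quotient_class raddfD. Qed.

Lemma quotient_classB : {morph quotient_class : x y / x - y}.
Proof. by move=> x y; rewrite /quotient_class raddfB. Qed.

Definition quotient_scale (k : K) (q : quotient_algebra) : quotient_algebra :=
  quotient_class (k *: quotient_repr q).

Definition quotient_mul (p q : quotient_algebra) : quotient_algebra :=
  quotient_class (quotient_repr p ** quotient_repr q).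

Lemma quotient_class_scale k x :
  quotient_scale k (quotient_class x) = quotient_class (k *: x).
Proof.
apply/quotient_classP; rewrite -scalerBr; apply: idealZ.
by apply/quotient_classP; rewrite quotient_reprK.
Qed.

Lemma bmulBl (x y z : A) : (x - y) ** z = x ** z - y ** z.
Proof. by rewrite bmulDl -[- y]scaleN1r bmulZl scaleN1r. Qed.

Lemma bmulBr (x y z : A) : x ** (y - z) = x ** y - x ** z.
Proof. by rewrite bmulDr -[- z]scaleN1r bmulZr scaleN1r. Qed.

Lemma quotient_class_mul x y :
  quotient_mul (quotient_class x) (quotient_class y) = quotient_class (x ** y).
Proof.
set x' := quotient_repr (quotient_class x).
set y' := quotient_repr (quotient_class y).
have xJ : ideal_set J (x' - x) by apply/quotient_classP; rewrite quotient_reprK.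
have yJ : ideal_set J (y' - y) by apply/quotient_classP; rewrite quotient_reprK.
apply/quotient_classP.
rewrite -(subrKA (x' ** y)) -bmulBr -bmulBl; apply: idealD.
  exact: ideal_mull.
exact: ideal_mulr.
Qed.

Fact quotient_scalerA a b q :
  quotient_scale a (quotient_scale b q) = quotient_scale (a * b) q.
Proof.
by rewrite -[q]quotient_reprK !quotient_class_scale scalerA.
Qed.

Fact quotient_scale1r : left_id 1 quotient_scale.
Proof. by move=> q; rewrite -[q]quotient_reprK quotient_class_scale scale1r. Qed.

Fact quotient_scalerDr : right_distributive quotient_scale +%R.
Proof.
move=> a p q; rewrite -[p]quotient_reprK -[q]quotient_reprK.
by rewrite -quotient_classD !quotient_class_scale scalerDr quotient_classD.
Qed.

Fact quotient_scalerDl q : {morph quotient_scale^~ q : a b / a + b}.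
Proof.
move=> a b; rewrite -[q]quotient_reprK.
by rewrite !quotient_class_scale scalerDl quotient_classD.
Qed.

HB.instance Definition _ := GRing.Zmodule_isLmodule.Build K quotient_algebra
  quotient_scalerA quotient_scale1r quotient_scalerDr quotient_scalerDl.

Lemma quotient_classZ k : {morph quotient_class : x / k *: x}.
Proof. by move=> x; rewrite -quotient_class_scale. Qed.

(* The norms of a K-normed module are elements of K; for K = R[i] the
   nonnegative elements are exactly the nonnegative reals, so this is the usual
   infimum of the norms over the coset q. *)
Definition quotient_norm (q : quotient_algebra) : K :=
  infimum 0 [set `|x| | x in [set x : A | quotient_class x = q]].

End QuotientModule.

Section QuotientNorm.
Variables (R : realType) (s : scalar_kind).
Local Notation K := (scalars R s).
Variables (A : banachAlgType K) (J : closed_ideal A).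
Local Notation Q := (quotient_algebra J).
Local Notation N := (@quotient_norm K A J).
Local Notation cl := (@quotient_class K A J).

Lemma quotient_norm_infimums q :
  infimums [set `|x| | x in [set x : A | cl x = q]] (N q).
Proof.
rewrite /quotient_norm /infimum; set S := [set _ | _ in _].
have S0 : S !=set0.
  exists `|quotient_repr q|, (quotient_repr q) => //; exact: quotient_reprK.
have [m mS] : infimums S !=set0.
  by apply: scalars_infimums => // _ [x _ <-].
by rewrite (negbTE ((set0P S).2 S0)); exact: xgetPex (ex_intro _ m mS).
Qed.

Lemma quotient_norm_le x : N (cl x) <= `|x|.
Proof. by have [+ _] := quotient_norm_infimums (cl x); apply; exists x. Qed.

Lemma quotient_norm_ge m q : (forall x, cl x = q -> m <= `|x|) -> m <= N q.
Proof.
by move=> H; have [_] := quotient_norm_infimums q; apply => _ [x /H ? <-].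
Qed.

Lemma quotient_norm_ge0 q : 0 <= N q.
Proof. exact: quotient_norm_ge. Qed.

Lemma quotient_norm_lift q e : 0 < e ->
  exists2 x, cl x = q & `|x| < N q + e.
Proof.
move=> e0; apply/not_exists2P => H.
have : N q + e <= N q.
  apply: quotient_norm_ge => x xq; have [//|/negP] := H x.
  by rewrite -real_leNgt // ger0_real // addr_ge0 ?quotient_norm_ge0 // ltW.
by rewrite gerDl => /(lt_le_trans e0); rewrite ltxx.
Qed.

Fact quotient_normD p q : N (p + q) <= N p + N q.
Proof.
rewrite -lerBlDr; apply: quotient_norm_ge => x xp.
rewrite lerBlDr -lerBlDl; apply: quotient_norm_ge => y yq.
rewrite lerBlDl -xp -yq -quotient_classD.
exact: le_trans (quotient_norm_le _) (ler_normD _ _).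
Qed.

Fact quotient_normZ (k : K) q : N (k *: q) = `|k| * N q.
Proof.
have le1 (l : K) p : l != 0 -> `|l| * N p <= N (l *: p).
  move=> l0; apply: quotient_norm_ge => x xp.
  rewrite -ler_pdivlMl ?normr_gt0 // -normfV -normrZ.
  suff -> : p = cl (l^-1 *: x) by exact: quotient_norm_le.
  by rewrite quotient_classZ xp scalerA mulVf // scale1r.
have [->|k0] := eqVneq k 0.
  rewrite scale0r normr0 mul0r; apply/eqP; rewrite eq_le quotient_norm_ge0 andbT.
  by rewrite -quotient_class0 (le_trans (quotient_norm_le _)) // normr0.
apply/eqP; rewrite eq_le le1 // andbT.
rewrite -ler_pdivrMl ?normr_gt0 // -normfV.
by rewrite (le_trans (le1 _ _ _)) ?invr_eq0 // scalerA mulVf // scale1r.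
Qed.

Fact quotient_norm0_eq0 q : N q = 0 -> q = 0.
Proof.
move=> q0; rewrite -[q]quotient_reprK -quotient_class0.
apply/quotient_classP; rewrite subr0.
apply: (@ideal_closed _ _ J) => U /nbhs_ballP[e /= e0 eU].
have [x xq xe] := quotient_norm_lift q e0; rewrite q0 add0r in xe.
exists (quotient_repr q - x); split.
  by rewrite /=; apply/quotient_classP; rewrite quotient_reprK.
by apply: eU; rewrite -ball_normE /= opprB addrC subrK.
Qed.

HB.instance Definition _ := Lmodule_isNormed.Build K Q
  quotient_normD quotient_normZ quotient_norm0_eq0.

Lemma quotient_normE (q : Q) : `|q| = N q.
Proof. by []. Qed.

End QuotientNorm.

Section QuotientComplete.
Variables (R : realType) (s : scalar_kind).
Local Notation K := (scalars R s).
Variables (A : banachAlgType K) (J : closed_ideal A).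
Local Notation Q := (quotient_algebra J).
Local Notation N := (@quotient_norm K A J).
Local Notation cl := (@quotient_class K A J).

Fact quotient_complete (F : set_system Q) :
  ProperFilter F -> cauchy F -> cvg F.
Proof.
move=> FF /cauchyP Fc.
pose r n : K := (2 ^+ n)^-1.
have r0 n : 0 < r n by rewrite invr_gt0 exprn_gt0.
have rS n : r n.+1 *+ 2 = r n.
  by rewrite /r exprS invfM -[LHS]mulr_natl mulrA divff ?mul1r // pnatr_eq0.
have /choice[q qF] n : exists x, F (ball x (r n)) by apply: Fc.
have qq n : N (q n.+1 - q n) < r n *+ 2.
  have [x [xn xS]] := filter_ex (filterI (qF n) (qF n.+1)).
  rewrite -ball_normE /= in xn; rewrite -ball_normE /= in xS.
  rewrite -quotient_normE -(subrKA x) (le_lt_trans (ler_normD _ _)) //.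
  rewrite [X in _ + X]distrC mulr2n ltrD //; apply: lt_le_trans xS _.
  by rewrite -(rS n) mulr2n lerDl ltW.
have /choice[d dP] n : exists x, cl x = q n.+1 - q n /\ `|x| < r n *+ 2.
  have e0 : 0 < r n *+ 2 - N (q n.+1 - q n) by rewrite subr_gt0.
  have [x xq xe] := quotient_norm_lift (q n.+1 - q n) e0.
  by exists x; rewrite addrC subrK in xe.
pose a n := quotient_repr (q 0%N) + \sum_(0 <= i < n) d i.
have aS n : a n.+1 = a n + d n by rewrite /a big_nat_recr //= addrA.
have aq n : cl (a n) = q n.
  elim: n => [|n IH]; first by rewrite /a big_nil addr0 quotient_reprK.
  by rewrite aS quotient_classD IH (dP n).1 addrC subrK.
have ad n k : `|a n - a (n + k)%N| <= r n *+ 4 - r (n + k)%N *+ 4.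
  elim: k => [|k IH]; first by rewrite addn0 !subrr normr0.
  rewrite addnS aS opprD addrA (le_trans (ler_normB _ _)) //.
  apply: le_trans (lerD IH (ltW (dP _).2)) _.
  rewrite -(rS (n + k)%N) -!mulrnA -addrA lerD2l.
  by rewrite -[(2 * 4)%N]/(4 + 4)%N mulrnDr opprD -[(2 * 2)%N]/4%N subrK.
have ad4 n m : (n <= m)%N -> `|a n - a m| < r n *+ 4.
  move=> /subnKC <-; apply: le_lt_trans (ad _ _) _.
  by rewrite ltrBlDr ltrDl mulrn_wgt0.
have rlt (e : K) : 0 < e -> exists n, forall m, (n <= m)%N -> r m < e.
  move=> /scalars_exp2V_lt[n ne]; exists n => m nm; apply: le_lt_trans ne.
  by rewrite lef_pV2 ?posrE ?exprn_gt0 // ler_eXn2l // ltr1n.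
have ac : cvg (a @ \oo).
  apply: cauchy_cvg; apply: cauchy_exP => e e0.
  have e40 : 0 < e / 4 by rewrite divr_gt0.
  have [n nP] := rlt _ e40.
  exists (a n); exists n => // m /= nm; rewrite -ball_normE /=.
  apply: lt_trans (ad4 _ _ nm) _.
  by rewrite -mulr_natr -ltr_pdivlMr // nP.
apply/cvg_ex; exists (cl (lim (a @ \oo))).
apply/cvgrPdist_lt => e e0.
have e20 : 0 < e / 2 by rewrite divr_gt0.
have [n nP] := rlt _ e20.
have /cvgrPdist_lt/(_ _ e20)[n' _ n'P] := ac.
pose m := maxn n n'.
near=> p.
rewrite -(subrKA (q m)) (le_lt_trans (ler_normD _ _)) // (splitr e) ltrD //.
  rewrite -aq -quotient_classB (le_lt_trans (quotient_norm_le _ _)) //.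
  by apply: n'P; rewrite /= leq_maxr.
apply: lt_trans (nP m (leq_maxl _ _)).
suff : ball (q m) (r m) p by rewrite -ball_normE.
near: p; exact: qF.
Unshelve. all: by end_near. Qed.

HB.instance Definition _ := Uniform_isComplete.Build Q quotient_complete.

Fact quotient_mulA : associative (@quotient_mul K A J).
Proof.
move=> x y z; rewrite -[x]quotient_reprK -[y]quotient_reprK -[z]quotient_reprK.
by rewrite !quotient_class_mul bmulA.
Qed.

Fact quotient_mulDl : left_distributive (@quotient_mul K A J) +%R.
Proof.
move=> x y z; rewrite -[x]quotient_reprK -[y]quotient_reprK -[z]quotient_reprK.
by rewrite -quotient_classD !quotient_class_mul -quotient_classD bmulDl.
Qed.

Fact quotient_mulDr : right_distributive (@quotient_mul K A J) +%R.
Proof.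
move=> x y z; rewrite -[x]quotient_reprK -[y]quotient_reprK -[z]quotient_reprK.
by rewrite -quotient_classD !quotient_class_mul -quotient_classD bmulDr.
Qed.

Fact quotient_mulZl (k : K) (x y : Q) :
  quotient_mul (k *: x) y = k *: quotient_mul x y.
Proof.
rewrite -[x]quotient_reprK -[y]quotient_reprK.
by rewrite -quotient_classZ !quotient_class_mul -quotient_classZ bmulZl.
Qed.

Fact quotient_mulZr (k : K) (x y : Q) :
  quotient_mul x (k *: y) = k *: quotient_mul x y.
Proof.
rewrite -[x]quotient_reprK -[y]quotient_reprK.
by rewrite -quotient_classZ !quotient_class_mul -quotient_classZ bmulZr.
Qed.

Fact quotient_norm_mul_le (p q : Q) : `|quotient_mul p q| <= `|p| * `|q|.
Proof.
have le1 x : `|quotient_mul (cl x) q| <= `|x| * `|q|.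
  have [->|x0] := eqVneq x 0.
    rewrite -[q]quotient_reprK quotient_class_mul.
    rewrite -[X in X ** _](scale0r 0) bmulZl scale0r quotient_class0.
    by rewrite !normr0 mul0r.
  rewrite mulrC -ler_pdivrMr ?normr_gt0 //; apply: quotient_norm_ge => y yq.
  rewrite ler_pdivrMr ?normr_gt0 // -yq quotient_class_mul mulrC.
  exact: le_trans (quotient_norm_le _ _) (normr_bmul_le _ _).
have [->|q0] := eqVneq q 0.
  suff -> : quotient_mul p 0 = 0 by rewrite !normr0 mulr0.
  by rewrite -[X in quotient_mul p X](scale0r 0) quotient_mulZr scale0r.
rewrite -ler_pdivrMr ?normr_gt0 //; apply: quotient_norm_ge => x xp.
by rewrite ler_pdivrMr ?normr_gt0 // -xp.
Qed.

HB.instance Definition _ := isBanachAlgebra.Build K Q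
  quotient_mulA quotient_mulDl quotient_mulDr quotient_mulZl quotient_mulZr
  quotient_norm_mul_le.

Lemma quotient_classM (x y : A) : cl (x ** y) = cl x ** cl y.
Proof. by rewrite -quotient_class_mul. Qed.

End QuotientComplete.

Section OpenMultiplication.
Variables (K : numFieldType) (A : banachAlgType K).

Definition admissible (x y : A) (eps delta : K) : Prop :=
  0 < delta /\
  ball (x ** y) delta `<=` [set u ** v | u in ball x eps & v in ball y eps].

Definition open_multiplication : Prop :=
  forall (x y : A) (eps : K), 0 < eps -> exists delta, admissible x y eps delta.

Definition witnesses_uniform_openness (delta : K -> K) : Prop :=
  forall eps, 0 < eps -> forall x y : A, admissible x y eps (delta eps).

Definition uniformly_open_multiplication : Prop :=
  exists delta, witnesses_uniform_openness delta.

Definition weakly_open_multiplication : Prop :=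
  forall W : set (A * A), open W -> W !=set0 ->
    ([set w.1 ** w.2 | w in W])° !=set0.

End OpenMultiplication.

Arguments open_multiplication {K} A.
Arguments witnesses_uniform_openness {K} A delta.
Arguments uniformly_open_multiplication {K} A.
Arguments weakly_open_multiplication {K} A.

(* Main.v *)
(* The quotient map sends open balls onto open balls of the same radius and is
   multiplicative, so admissibility passes to the quotient unchanged. For a
   bounded surjection the open mapping theorem gives the same up to constants:
   balls of radius eps / M map into balls of radius eps, and the image of a
   ball of radius delta contains the ball of radius delta / C with the same
   (image) centre. *)
Require Import Defs.
From mathcomp Require Import all_boot all_order all_algebra.
From mathcomp Require Import all_classical all_reals.
From mathcomp Require Import topology normedtype sequences.
From mathcomp Require Import ring.

Set Implicit Arguments.
Unset Strict Implicit.
Unset Printing Implicit Defensive.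

Import Order.TTheory GRing.Theory Num.Theory.
Import numFieldNormedType.Exports.

Local Open Scope classical_set_scope.
Local Open Scope ring_scope.

(** * Quantitative open mapping theorem *)

Section BanachOpenMapping.
Variable K : numFieldType.
(** The Archimedean property, assumed abstractly so that real and complex scalars are treated
    together. *)
Hypothesis exp2V_lt : forall e : K, 0 < e -> exists n, (2 ^+ n)^-1 < e.

Lemma exp2V_small (c e : K) : 0 <= c -> 0 < e -> exists n, c * (2 ^+ n)^-1 < e.
Proof.
move=> c0 e0; have c1 : 0 < c + 1 by rewrite ltr_wpDl.
have [n ne] := exp2V_lt (divr_gt0 e0 c1); exists n.
rewrite (@le_lt_trans _ _ ((c + 1) * (2 ^+ n)^-1)) //.
  by rewrite ler_wpM2r ?lerDl // invr_ge0 exprn_ge0.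
by rewrite mulrC -ltr_pdivlMr.
Qed.

Lemma exp2_gt (c : K) : 0 <= c -> exists n, c < 2 ^+ n.
Proof.
move=> c0; have [n] := exp2V_small c0 ltr01.
by rewrite ltr_pdivrMr ?exprn_gt0 // mul1r; exists n.
Qed.

(** The witness [x * y / (x + y)] replaces a minimum, as the order of [K] need not be total. *)
Lemma lt_common (x y : K) : 0 < x -> 0 < y ->
  exists z, [/\ 0 < z, z < x & z < y].
Proof.
move=> x0 y0; have xy0 : 0 < x + y by rewrite addr_gt0.
exists (x * y / (x + y)); split; first by rewrite !(mulr_gt0, invr_gt0).
  by rewrite ltr_pdivrMr // ltr_pM2l // ltrDr.
by rewrite ltr_pdivrMr // mulrC ltr_pM2l // ltrDl.
Qed.

Lemma le_eps_norm (V : normedModType K) (x : V) (r : K) : 0 <= r ->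
  (forall e, 0 < e -> `|x| < r + e) -> `|x| <= r.
Proof.
move=> r0 H; rewrite real_leNgt ?realE ?normr_ge0 ?r0 //; apply/negP => rx.
have /H : 0 < `|x| - r by rewrite subr_gt0.
by rewrite addrC subrK ltxx.
Qed.

(** Completeness with the rate kept: the bound on [u n - u m] passes to the limit in [m]. *)
Lemma cauchy_rate_limit (V : completeNormedModType K) (u : nat -> V)
    (rho : nat -> K) :
  (forall n, 0 <= rho n) ->
  (forall e, 0 < e -> exists n, rho n < e) ->
  (forall n m, (n <= m)%N -> `|u n - u m| <= rho n) ->
  exists l, forall n, `|u n - l| <= rho n.
Proof.
move=> rho0 rho_small u_rho.
have uc : cvg (u @ \oo).
  apply: cauchy_cvg; apply: cauchy_exP => e /rho_small[n ne].
  exists (u n); exists n => // m /= nm; rewrite -ball_normE /=.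
  exact: le_lt_trans (u_rho _ _ nm) ne.
exists (lim (u @ \oo)) => n; apply: le_eps_norm => // e e0.
move/cvgrPdist_lt: uc => /(_ e e0)[m _ /(_ _ (leq_maxr n m)) um].
rewrite -(subrKA (u (maxn n m))) (le_lt_trans (ler_normD _ _)) //.
by rewrite ler_ltD ?u_rho ?leq_maxl // distrC.
Qed.

Section Surjection.
Variables (A B : completeNormedModType K) (h : {linear A -> B}).
Hypothesis h_surj : forall b, exists a, h a = b.

(* If no such ball existed, one could build nested balls whose common point is
   outside every [h (ball 0 (2 ^+ n))], against surjectivity. *)
Lemma dense_image_ball : exists n b0 r, 0 < r /\
  forall b, `|b - b0| < r -> forall e, 0 < e ->
    exists2 a, `|a| < 2 ^+ n & `|b - h a| < e.
Proof.
apply: contrapT => H.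
have step (p : nat * (B * K)) : exists q : B * K, 0 < p.2.2 ->
    [/\ 0 < q.2, q.2 <= (2 ^+ p.1)^-1, `|q.1 - p.2.1| + q.2 <= p.2.2
      & forall a, `|a| < 2 ^+ p.1 -> q.2 < `|q.1 - h a|].
  case: p => n [b0 r] /=.
  have [r0|] := pselect (0 < r); last by exists (b0, r).
  apply: contrapT => Hq; apply: H; exists n, b0, r; split => // b bb0 e e0.
  apply: contrapT => Ha; apply: Hq.
  have d0 : 0 < r - `|b - b0| by rewrite subr_gt0.
  have p0 : 0 < (2 ^+ n)^-1 :> K by rewrite invr_gt0 exprn_gt0.
  (* The new radius [t] is below [e] to miss the images [h a], below the gap [r - |b - b0|] to stay
     nested, and below [(2 ^+ n)^-1] to shrink to 0. *)
  have [z [z0 ze zd]] := lt_common e0 d0.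
  have [t [t0 tz tp]] := lt_common z0 p0.
  exists (b, t) => _ /=; split=> //; first exact: ltW.
    by rewrite -lerBrDl ltW // (lt_trans tz).
  move=> a an; apply: lt_le_trans tz _; apply: le_trans (ltW ze) _.
  rewrite real_leNgt ?normr_real ?gtr0_real //; apply/negP => ae.
  by apply: Ha; exists a.
move/choice: step => [f fP].
pose q := fix q n := if n is m.+1 then f (m, q m) else (0 : B, 1 : K).
have q0 n : 0 < (q n).2.
  by elim: n => [|n IH] /=; [exact: ltr01|have [] := fP (n, q n) IH].
have qS n : [/\ (q n.+1).2 <= (2 ^+ n)^-1,
    `|(q n.+1).1 - (q n).1| + (q n.+1).2 <= (q n).2
  & forall a, `|a| < 2 ^+ n -> (q n.+1).2 < `|(q n.+1).1 - h a|].
  by have [] := fP (n, q n) (q0 n).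
have nested n k : `|(q n).1 - (q (n + k)%N).1| + (q (n + k)%N).2 <= (q n).2.
  elim: k => [|k IH]; first by rewrite addn0 subrr normr0 add0r.
  apply: le_trans IH; rewrite addnS.
  have [_ nk _] := qS (n + k)%N.
  apply: le_trans (lerD (lexx _) nk); rewrite addrA lerD2r.
  by rewrite (distrC (q (n + k).+1).1) ler_distD.
have [|||c cP] := @cauchy_rate_limit B (fun n => (q n).1) (fun n => (q n).2).
- by move=> n; exact: ltW.
- move=> e /exp2V_lt[n ne]; exists n.+1.
  by have [qn _ _] := qS n; exact: le_lt_trans qn ne.
- move=> n m /subnKC <-; apply: le_trans (nested n (m - n)%N).
  by rewrite lerDl ltW.
(* The common point [c] is some [h a]; once [|a| < 2 ^+ n], the ball of index [n.+1] misses [h a]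
   but contains [c]. *)
have [a ac] := h_surj c.
have [n an] := exp2_gt (normr_ge0 a).
have [_ _ /(_ a an)] := qS n.
by rewrite ac => /lt_le_trans/(_ (cP _)); rewrite ltxx.
Qed.

(** Both [b0] and [b0 + t *: b] lie in a ball where images of bounded vectors are dense; subtracting
    their approximate preimages and dividing by [t] handles [b]. *)
Lemma approximate_preimage : exists2 C : K, 0 < C &
  forall b e, 0 < e -> exists2 a, `|a| <= C * `|b| & `|b - h a| < e.
Proof.
have [n [b0 [r [r0 br]]]] := dense_image_ball.
exists (2 ^+ n * 4 / r); first by rewrite divr_gt0 // mulr_gt0 ?exprn_gt0.
move=> b e e0; have [->|bN0] := eqVneq b 0.
  by exists 0; [rewrite !normr0 mulr0|rewrite linear0 subr0 normr0].
have b_gt0 : 0 < `|b| by rewrite normr_gt0.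
(* This makes [t *: b] of norm [r / 2], inside the ball. Two errors below [t * e / 2] then give [e]
   after division by [t]. *)
pose t := r / (2 * `|b|).
have t0 : 0 < t by rewrite divr_gt0 // mulr_gt0.
have te0 : 0 < t * e / 2 by rewrite divr_gt0 // mulr_gt0.
have tb : `|t *: b| = r / 2.
  by rewrite normrZ gtr0_norm // /t invfM mulrA divfK ?gt_eqF.
have [|a1 a1n a1e] := br (b0 + t *: b) _ _ te0.
  by rewrite addrC addKr tb ltr_pdivrMr // ltr_pMr // ltr1n.
have [|a2 a2n a2e] := br b0 _ _ te0; first by rewrite subrr normr0.
exists (t^-1 *: (a1 - a2)).
  rewrite normrZ gtr0_norm ?invr_gt0 // mulrC ler_pdivrMr //.
  have -> : 2 ^+ n * 4 / r * `|b| * t = 2 ^+ n + 2 ^+ n.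
    by rewrite /t; field; rewrite !gt_eqF.
  by rewrite (le_trans (ler_normB _ _)) // lerD // ltW.
rewrite -(@ltr_pM2l _ t) // -[X in X * `|_|](gtr0_norm t0) -normrZ.
rewrite scalerBr (linearZ_LR h) scalerA divff ?gt_eqF // scale1r (raddfB h).
rewrite (_ : _ - _ = (b0 + t *: b - h a1) - (b0 - h a2)); last first.
  by rewrite !opprB [RHS]addrC -[b0 + _ - _]addrA subrKA addrCA.
by rewrite (le_lt_trans (ler_normB _ _)) // [ltRHS]splitr ltrD.
Qed.

(** Successive approximation: each correction halves the residual, so the corrections sum to at most
    [2 * C * |b|], and boundedness of [h] identifies the image of the limit. *)
Lemma bounded_preimage (M : K) : 0 < M -> (forall x, `|h x| <= M * `|x|) ->
  exists2 C : K, 0 < C & forall b, exists2 a, h a = b & `|a| <= C * `|b|.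
Proof.
move=> M0 hM; have [C C0 approx] := approximate_preimage.
have /choice[g gP] b : exists a,
    `|a| <= C * `|b| /\ `|b - h a| <= `|b| / 2.
  have [->|bN0] := eqVneq b 0.
    by exists 0; rewrite linear0 subrr !normr0 mulr0 mul0r.
  have b20 : 0 < `|b| / 2 by rewrite divr_gt0 ?normr_gt0.
  by have [a aC /ltW] := approx b _ b20; exists a.
exists (2 * C) => [|b]; first by rewrite mulr_gt0.
pose S := fix S n := if n is m.+1 then S m + g (b - h (S m)) else 0.
pose r n : K := (2 ^+ n)^-1.
have r0 n : 0 < r n by rewrite invr_gt0 exprn_gt0.
have rS n : r n = 2 * r n.+1.
  by rewrite /r exprS invfM mulrA divff ?mul1r // pnatr_eq0.
have Sr n : `|b - h (S n)| <= `|b| * r n.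
  elim: n => [|n IH] /=; first by rewrite linear0 subr0 /r expr0 invr1 mulr1.
  rewrite linearD opprD addrA (le_trans (gP _).2) //.
  by rewrite ler_pdivrMr // -mulrA [_ * 2]mulrC -rS.
have SS n : `|g (b - h (S n))| <= C * `|b| * r n.
  by rewrite (le_trans (gP _).1) // -mulrA ler_pM2l.
have Cb0 : 0 <= C * `|b| by rewrite mulr_ge0 // ltW.
(* The geometric sum is kept as a difference so that the induction on [k] telescopes. *)
have Sd n k : `|S n - S (n + k)%N| <= 2 * C * `|b| * (r n - r (n + k)%N).
  elim: k => [|k IH]; first by rewrite addn0 !subrr normr0 mulr0.
  rewrite addnS /= opprD addrA (le_trans (ler_normB _ _)) //.
  apply: le_trans (lerD IH (SS _)) _.
  rewrite (rS (n + k)%N).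
  rewrite le_eqVlt; apply/orP; left; apply/eqP; ring.
have [|||a aP] := @cauchy_rate_limit A S (fun n => 2 * C * `|b| * r n).
- by move=> n; rewrite -mulrA -mulrA !mulr_ge0 // ltW.
- by move=> e e0; apply: exp2V_small => //; rewrite -mulrA mulr_ge0.
- move=> n m /subnKC <-; apply: le_trans (Sd _ _) _.
  by rewrite ler_wpM2l ?gerBl ?(ltW (r0 _)) // -mulrA mulr_ge0.
exists a; last first.
  by have := aP 0%N; rewrite /= sub0r normrN /r expr0 invr1 mulr1.
apply/esym/eqP; rewrite -subr_eq0 -normr_le0.
apply: le_eps_norm => // e e0; rewrite add0r.
(* The first summand bounds the residual at [S n], the second the image of [S n - a], both up to the
   factor [r n]. *)
have [|n] := @exp2V_small (`|b| + M * (2 * C * `|b|)) e _ e0.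
  by rewrite addr_ge0 // mulr_ge0 ?(ltW M0) // -mulrA mulr_ge0.
apply: le_lt_trans; rewrite -(subrKA (h (S n))) (le_trans (ler_normD _ _)) //.
rewrite mulrDl lerD // -linearB (le_trans (hM _)) //.
by rewrite -mulrA ler_pM2l.
Qed.

End Surjection.
End BanachOpenMapping.

(** Lift a point near [f x ** f y] to one near [x ** y], factor it there, and push both factors
    forward. *)
Lemma admissible_image (K : numFieldType) (A B : banachAlgType K) (f : A -> B)
    (x y : A) (eps eps' delta delta' : K) :
  (forall u v, f (u ** v) = f u ** f v) ->
  (forall u v, ball u eps v -> ball (f u) eps' (f v)) ->
  (forall u, ball (f u) delta' `<=` f @` ball u delta) ->
  0 < delta' -> admissible x y eps delta -> admissible (f x) (f y) eps' delta'.
Proof.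
move=> fM f_eps f_delta d'0 [_ xyd]; split=> // b; rewrite -fM => /f_delta[a].
move=> /xyd[u xu [v yv <-]] <-.
by exists (f u); [exact: f_eps|exists (f v); [exact: f_eps|rewrite fM]].
Qed.

(** * Transfer along the quotient map *)

Section QuotientMap.
Variables (R : realType) (s : scalar_kind).
Variables (A : banachAlgType (scalars R s)) (J : closed_ideal A).
Local Notation cl := (quotient_class J).

Lemma quotient_class_ball (u v : A) e : ball u e v -> ball (cl u) e (cl v).
Proof.
rewrite -!ball_normE /= -quotient_classB.
exact: le_lt_trans (quotient_norm_le _ _).
Qed.

Lemma quotient_class_ball_image (u : A) d : ball (cl u) d `<=` cl @` ball u d.
Proof.
move=> q; rewrite -ball_normE /= => uq.
(* The infimum need not be attained, but this slack leaves room for a representative of norm below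
   [d]. *)
have d0 : 0 < d - `|cl u - q| by rewrite subr_gt0.
have [z zq zd] := quotient_norm_lift (cl u - q) d0.
exists (u - z); last by rewrite quotient_classB zq subKr.
rewrite -ball_normE /= subKr; move: zd; rewrite -quotient_normE addrC subrK.
exact.
Qed.

Lemma admissible_quotient (x y : A) eps delta : admissible x y eps delta ->
  admissible (cl x) (cl y) eps delta.
Proof.
move=> xyd; have [d0 _] := xyd.
apply: (admissible_image (quotient_classM J) _ _ d0 xyd).
  by move=> u v; exact: quotient_class_ball.
by move=> u q; exact: quotient_class_ball_image.
Qed.

Lemma open_multiplication_quotient :
  open_multiplication A -> open_multiplication (quotient_algebra J).
Proof.
move=> oA p q eps e0.
have [d xyd] := oA (quotient_repr p) (quotient_repr q) eps e0.
by exists d; have := admissible_quotient xyd; rewrite !quotient_reprK.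
Qed.

Lemma witnesses_uniform_openness_quotient delta :
  witnesses_uniform_openness A delta ->
  witnesses_uniform_openness (quotient_algebra J) delta.
Proof.
move=> oA eps e0 p q.
have := admissible_quotient (oA eps e0 (quotient_repr p) (quotient_repr q)).
by rewrite !quotient_reprK.
Qed.

Lemma quotient_class_continuous : continuous (cl : A -> quotient_algebra J).
Proof.
move=> x; apply/cvg_ballP => e e0; near=> y; apply: quotient_class_ball.
by near: y; exact: nbhsx_ballx.
Unshelve. all: by end_near. Qed.

(** Pull [W] back to [A * A] by continuity; a ball inside the resulting set of products maps onto a
    ball of the same radius in the quotient. *)
Lemma weakly_open_multiplication_quotient :
  weakly_open_multiplication A ->
  weakly_open_multiplication (quotient_algebra J).
Proof.
move=> wA W oW [[p q] Wpq].
pose clW := (fun w : A * A => (cl w.1, cl w.2)) @^-1` W.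
have oclW : open clW.
  apply: open_comp => // -[x y] _ /=.
  apply: (@cvg_pair _ _ _ _ (nbhs (cl x)) (nbhs (cl y))).
    by apply: (cvg_comp _ _ cvg_fst); exact: quotient_class_continuous.
  by apply: (cvg_comp _ _ cvg_snd); exact: quotient_class_continuous.
have [|z /nbhs_ballP[e /= e0 ez]] := wA clW oclW.
  by exists (quotient_repr p, quotient_repr q); rewrite /clW /= !quotient_reprK.
exists (cl z); apply/nbhs_ballP; exists e => //= r /quotient_class_ball_image[a].
move=> /ez[[u v] uvW <-] <-.
by exists (cl u, cl v) => //=; rewrite quotient_classM.
Qed.

End QuotientMap.

(** * Transfer along bounded surjective homomorphisms *)

Lemma admissible_surjection (R : realType) (s : scalar_kind)
    (A B : banachAlgType (scalars R s)) (h : {linear A -> B})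
    (M : scalars R s) :
  (forall x y, h (x ** y) = h x ** h y) ->
  (forall x, `|h x| <= M * `|x|) ->
  (forall b, exists a, h a = b) ->
  exists M' C : scalars R s, [/\ 0 < M', 0 < C &
    forall x y eps delta, admissible x y (eps / M') delta ->
      admissible (h x) (h y) eps (delta / C)].
Proof.
move=> hM hle hsurj; pose M' := `|M| + 1.
have M'0 : 0 < M' by rewrite ltr_wpDl.
(* [M] need not be nonnegative when [A] is trivial. *)
have hle' x : `|h x| <= M' * `|x|.
  have Mx := hle x; have Mx0 : 0 <= M * `|x| := le_trans (normr_ge0 _) Mx.
  rewrite (le_trans Mx) // -(ger0_norm Mx0) normrM normr_id.
  by rewrite ler_wpM2r // lerDl.
have [C C0 lift] := bounded_preimage (@scalars_exp2V_lt R s) hsurj M'0 hle'.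
exists M', C; split=> // x y eps delta xyd; have [d0 _] := xyd.
apply: (admissible_image hM _ _ _ xyd); last by rewrite divr_gt0.
  move=> u v; rewrite -!ball_normE /= -linearB => uv.
  by rewrite (le_lt_trans (hle' _)) // mulrC -ltr_pdivlMr.
move=> u b; rewrite -ball_normE /= => ub.
have [a ab aC] := lift (h u - b).
exists (u - a); last by rewrite linearB ab subKr.
by rewrite -ball_normE /= subKr (le_lt_trans aC) // mulrC -ltr_pdivlMr.
Qed.

Theorem lemma3p1 (R : realType) (s : scalar_kind)
    (A B : banachAlgType (scalars R s)) (J : closed_ideal A) :
  (* (i) *)
  [/\ (open_multiplication A ->
         open_multiplication (quotient_algebra J) /\
         (forall (x y : A) (eps delta : scalars R s), 0 < eps ->
            admissible x y eps delta ->
            admissible (quotient_class J x) (quotient_class J y) eps delta)),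
      (uniformly_open_multiplication A ->
         uniformly_open_multiplication (quotient_algebra J) /\
         (forall delta : scalars R s -> scalars R s,
            witnesses_uniform_openness A delta ->
            witnesses_uniform_openness (quotient_algebra J) delta))
    & (weakly_open_multiplication A ->
         weakly_open_multiplication (quotient_algebra J))]
  /\
  (* (ii) *)
  (forall h : {linear A -> B},
     (forall x y : A, h (x ** y) = h x ** h y) ->
     (exists M : scalars R s, forall x : A, `|h x| <= M * `|x|) ->
     (forall b : B, exists a : A, h a = b) ->
     (open_multiplication A -> open_multiplication B) /\
     (uniformly_open_multiplication A -> uniformly_open_multiplication B)).
Proof.
split.
  split.
  - move=> oA; split=> [|x y eps delta _].
      exact: open_multiplication_quotient.
    exact: admissible_quotient.
  - move=> [d dP]; split=> [|delta].
      by exists d; exact: witnesses_uniform_openness_quotient.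
    exact: witnesses_uniform_openness_quotient.
  - exact: weakly_open_multiplication_quotient.
move=> h hM [M hle] hsurj.
have [M' [C [M'0 C0 hP]]] := admissible_surjection hM hle hsurj.
split=> [oA b c eps e0|[delta dP]].
  have [[x <-] [y <-]] := (hsurj b, hsurj c).
  have [d xyd] := oA x y _ (divr_gt0 e0 M'0).
  by exists (d / C); exact: hP.
(* Since [M'] and [C] do not depend on the points, rescaling a uniform witness leaves it uniform. *)
exists (fun eps => delta (eps / M') / C) => eps e0 b c.
have [[x <-] [y <-]] := (hsurj b, hsurj c).
by apply: hP; apply: dP; rewrite divr_gt0.
Qed.
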